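(* Let $a \in \mathbb{R}$, let $0 < \nu < 1$, and let $c : \mathbb{N}_{a+1} \to \mathbb{R}$ satisfy $|c(t) + \nu| \leq \nu$ for all $t \in \mathbb{N}_{a+1}$. Then every solution $u : \mathbb{N}_a \to \mathbb{R}$ of $$\big(\nabla^{\nu}_{\rho(a)} u\big)(t) = c(t)\,u(t-1), \quad t \in \mathbb{N}_{a+1},$$ satisfies $$\lim_{t \to \infty} u(t) = 0.$$
   Context: For a real number $a$, $\mathbb{N}_a = \{a, a+1, a+2, \ldots\}$, and $\rho(t) = t-1$ (so $\rho(a) = a-1$). Sums $\sum_{s=a}^{t}$ with $t \in \mathbb{N}_a$ run over $s = a, a+1, \ldots, t$, and limits as $t \to \infty$ are taken along $t \in \mathbb{N}_a$. For a non-integer real $\mu$ and $t \in b + \{1,2,3,\ldots\}$, the nabla fractional Taylor monomial is $$H_{\mu}(t,b) = \frac{\Gamma(t-b+\mu)}{\Gamma(t-b)\,\Gamma(\mu+1)},$$ where $\Gamma$ is the Euler gamma function. For $u : \mathbb{N}_a \to \mathbb{R}$ and $0 < \nu < 1$, $\nabla^{\nu}_{\rho(a)} u$ denotes the $\nu$-th order Riemann–Liouville nabla fractional difference of $u$ based at $\rho(a) = a-1$: $\big(\nabla^{\nu}_{\rho(a)} u\big)(t) = v(t) - v(t-1)$, where $v(t) = \sum_{s=a}^{t} H_{-\nu}(t,\rho(s))\,u(s)$ for $t \in \mathbb{N}_a$ and $v(a-1) = 0$. Equivalently (a known fact), for all $t \in \mathbb{N}_{a+1}$, $$\big(\nabla^{\nu}_{\rho(a)}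 u\big)(t) = \sum_{s=a}^{t} H_{-\nu-1}(t,\rho(s))\,u(s), \qquad H_{-\nu-1}(t,\rho(s)) = \frac{\Gamma(t-s-\nu)}{\Gamma(t-s+1)\,\Gamma(-\nu)}.$$ *)

(* Defs.v *)
From HB Require Import structures.
From mathcomp Require Import all_boot all_order all_algebra.
From mathcomp Require Import all_classical all_reals all_analysis.
Set Implicit Arguments.
Unset Strict Implicit.
Unset Printing Implicit Defensive.
Import Order.TTheory GRing.Theory Num.Theory.
Import numFieldNormedType.Exports.
Local Open Scope classical_set_scope.
Local Open Scope ring_scope.

Definition Nfrom (R : realType) (a : R) : set R :=
  [set a + n%:R | n in [set: nat]].

Definition rho (R : realType) (t : R) : R := t - 1.

(* Euler's integral; it converges, and is the Gamma function, for 0 < x. *)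
Definition Euler_integral (R : realType) (x : R) : R :=
  Rintegral lebesgue_measure `]0, +oo[ (fun s : R => s `^ (x - 1) * expR (- s)).

(* For x <= 0, n is the least natural number with 0 < x + n, and
   Gamma x = Gamma (x + n) / (x (x + 1) ... (x + n - 1)).
   At the poles x = 0, -1, -2, ... the denominator is 0 and the value is the
   junk value 0. *)
Definition Gamma (R : realType) (x : R) : R :=
  let n := if 0 < x then 0%N else (Num.truncn (- x)).+1 in
  Euler_integral (x + n%:R) / \prod_(i < n) (x + i%:R).

Definition nabla_taylor (R : realType) (mu t b : R) : R :=
  Gamma (t - b + mu) / (Gamma (t - b) * Gamma (mu + 1)).

Definition nabla (R : realType) (v : R -> R) (t : R) : R := v t - v (rho t).

(* Only the values of u on Nfrom a are used; for t = rho a the index set is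
   empty and the sum is 0. *)
Definition RL_nabla_sum (R : realType) (nu a : R) (u : R -> R) (t : R) : R :=
  \sum_(s \in [set s | Nfrom a s /\ s <= t]) nabla_taylor (- nu) t (rho s) * u s.

(* Riemann-Liouville nabla fractional difference of order 0 < nu < 1, based at
   rho a. *)
Definition RL_nabla (R : realType) (nu a : R) (u : R -> R) : R -> R :=
  nabla (RL_nabla_sum nu a u).

(* Main.v *)
(* Write u_n = u (a + n).  With (x)_k / k! for the rising factorial quotient, the
   Gamma ratios in the difference operator are H_(-nu)(a+n, rho(a+s)) =
   (1 - nu)_(n-s) / (n-s)!, whose differences are the coefficients
   w_k = (-nu)_k / k! of (1 - z)^nu.  The equation becomes
   u_n = (c + nu) u_(n-1) - sum_(k >= 2) w_k u_(n-k), where w_0 = 1, w_1 = - nu and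
   w_k <= 0 for k >= 1; as |c + nu| <= nu this gives
   |u_n| <= sum_(k >= 1) |w_k| |u_(n-k)|.  The coefficients (nu)_n / n! of
   (1 - z)^(- nu) satisfy this recursion with equality (Vandermonde), so
   |u_n| <= |u_0| (nu)_n / n!, which tends to 0 because
   (nu)_n / n! <= exp (- (1 - nu) (1 + 1/2 + ... + 1/n)). *)
Require Import Defs.
From HB Require Import structures.
From mathcomp Require Import all_boot all_order all_algebra.
From mathcomp Require Import all_classical all_reals all_analysis.
From mathcomp Require Import measurable_realfun ring lra.
Set Implicit Arguments.
Unset Strict Implicit.
Unset Printing Implicit Defensive.
Import Order.TTheory GRing.Theory Num.Theory.
Import numFieldNormedType.Exports.
Local Open Scope classical_set_scope.
Local Open Scope ring_scope.

(** * Rising factorial quotients *)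

(** The coefficient of z^k in (1 - z)^(-x). *)
Definition rbin (F : numFieldType) (x : F) (k : nat) : F :=
  \prod_(i < k) ((x + i%:R) / i.+1%:R).

Lemma rbin0 (F : numFieldType) (x : F) : rbin x 0 = 1.
Proof. by rewrite /rbin big_ord0. Qed.

Lemma rbinS (F : numFieldType) (x : F) k :
  rbin x k.+1 = rbin x k * ((x + k%:R) / k.+1%:R).
Proof. by rewrite /rbin big_ord_recr. Qed.

Lemma rbin1 (F : numFieldType) (x : F) : rbin x 1 = x.
Proof. by rewrite rbinS rbin0 mul1r addr0 divr1. Qed.

Lemma rbin_zero (F : numFieldType) k : rbin (0 : F) k.+1 = 0.
Proof. by rewrite /rbin big_ord_recl addr0 !mul0r. Qed.

Lemma mulr_rbinS (F : numFieldType) (x : F) k :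
  k.+1%:R * rbin x k.+1 = (x + k%:R) * rbin x k.
Proof. by rewrite rbinS mulrC -mulrA divfK ?pnatr_eq0// mulrC. Qed.

(** Multiplying the series (1 - z)^(-x) by 1 - z lowers [x] by one and takes differences of its
    coefficients. *)
Lemma rbin_diff (F : numFieldType) (x : F) k :
  rbin x k.+1 - rbin x k = rbin (x - 1) k.+1.
Proof.
(* The numerators satisfy (x - 1)_(k+1) = (x - 1) (x)_k. *)
have rbin_shift : rbin (x - 1) k.+1 = rbin x k * ((x - 1) / k.+1%:R).
  elim: k => [|k IH]; first by rewrite rbin1 rbin0 mul1r divr1.
  rewrite rbinS IH rbinS.
  have k1 : k.+1%:R != 0 :> F by rewrite pnatr_eq0.
  have k2 : k.+2%:R != 0 :> F by rewrite pnatr_eq0.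
  rewrite -[k.+2%:R]natr1 in k2 *; rewrite -[k.+1%:R]natr1 in k1 k2 *.
  by field; rewrite k1 k2.
rewrite rbin_shift rbinS -{2}[rbin x k]mulr1 -mulrBr; congr (_ * _).
have k1 : k.+1%:R != 0 :> F by rewrite pnatr_eq0.
by rewrite -natr1 in k1 *; field.
Qed.

(* Both sides of (n+1) P(n+1) = (x + y + n) P(n) come from splitting
   n + 1 = k + (n + 1 - k) and absorbing each summand by mulr_rbinS. *)
Lemma rbin_Vandermonde (F : numFieldType) (x y : F) n :
  \sum_(k < n.+1) rbin x k * rbin y (n - k) = rbin (x + y) n.
Proof.
elim: n => [|n IH]; first by rewrite big_ord1 subnn !rbin0 mulr1.
have n1 : n.+1%:R != 0 :> F by rewrite pnatr_eq0.
apply: (mulfI n1); rewrite mulr_rbinS -IH !mulr_sumr.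
have split_k (k : 'I_n.+2) : n.+1%:R * (rbin x k * rbin y (n.+1 - k)) =
    k%:R * rbin x k * rbin y (n.+1 - k) +
    rbin x k * ((n.+1 - k)%:R * rbin y (n.+1 - k)).
  by rewrite natrB -1?ltnS//; ring.
under eq_bigr do rewrite split_k.
(* The first term of the first sum and the last term of the second vanish, so both sums can be
   indexed by ['I_n.+1]. *)
rewrite big_split/= big_ord_recl/= mul0r mul0r add0r.
rewrite [X in _ + X]big_ord_recr/= subnn mul0r mulr0 addr0 -big_split/=.
apply: eq_bigr => k _; rewrite subSS /bump/= add1n mulr_rbinS.
have kn : (k <= n)%N by rewrite -ltnS.
by rewrite subSn// mulr_rbinS natrB//; ring.
Qed.

Lemma rbin_ge0 (F : numFieldType) (x : F) k : 0 <= x -> 0 <= rbin x k.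
Proof. by move=> x0; apply: prodr_ge0 => i _; rewrite divr_ge0// addr_ge0. Qed.

(** Only the leading factor [- x] can be negative: the later numerators are i - x with i >= 1 >=
    x. *)
Lemma rbinN_le0 (F : realFieldType) (x : F) k :
  0 <= x -> x <= 1 -> rbin (- x) k.+1 <= 0.
Proof.
move=> x0 x1; rewrite /rbin big_ord_recl addr0 divr1 mulNr oppr_le0 mulr_ge0//.
apply: prodr_ge0 => i _; rewrite divr_ge0//= /bump/= add1n.
by rewrite addrC subr_ge0 (le_trans x1)// ler1n.
Qed.

(** * Comparison with the coefficients of (1 - z)^(-nu), and their decay *)

(** Strong induction on [n]. The index of [c] is shifted: [c n] is the coefficient in the equation
    at time n + 1. *)
Lemma rbin_comparison (F : realFieldType) (nu : F) (c u : nat -> F) :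
  0 <= nu -> nu <= 1 -> (forall n, `|c n + nu| <= nu) ->
  (forall n, \sum_(s < n.+2) rbin (1 - nu) (n.+1 - s) * u s -
             \sum_(s < n.+1) rbin (1 - nu) (n - s) * u s = c n * u n) ->
  forall n, `|u n| <= `|u 0| * rbin nu n.
Proof.
move=> nu0 nu1 cnu eqn n.
have [m] := ubnP n; elim: m n => // m IH [|n]; first by rewrite rbin0 mulr1.
rewrite ltnS => nm.
(* Solve for the newest value, whose weight is 1. The term s = n of the remaining sum has weight
   [- nu]; moved to the right, it turns [c n] into [c n + nu]. *)
have uS : u n.+1 = (c n + nu) * u n
    + \sum_(s < n) - rbin (- nu) (n.+1 - s) * u s.
  have := eqn n; rewrite big_ord_recr/= subnn rbin0 mul1r addrAC -sumrB.
  have -> : \sum_(s < n.+1) (rbin (1 - nu) (n.+1 - s) * u s -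
      rbin (1 - nu) (n - s) * u s) = \sum_(s < n.+1) rbin (- nu) (n.+1 - s) * u s.
    apply: eq_bigr => s _; have sn : (s <= n)%N by rewrite -ltnS.
    by rewrite -mulrBl !subSn// rbin_diff addrAC subrr add0r.
  rewrite big_ord_recr/= subSnn rbin1.
  under [in X in _ -> X]eq_bigr do rewrite mulNr.
  rewrite sumrN => /eqP; rewrite -subr_eq0 => /eqP E.
  by apply/eqP; rewrite -subr_eq0; apply/eqP; rewrite -[RHS]E; ring.
(* Since (1 - z)^(-nu) (1 - z)^nu = 1, the convolution vanishes at every positive order. *)
have Vdm : rbin nu n.+1 = \sum_(s < n.+1) - rbin (- nu) (n.+1 - s) * rbin nu s.
  have := rbin_Vandermonde nu (- nu) n.+1.
  rewrite subrr rbin_zero big_ord_recr/= subnn rbin0 mulr1.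
  under [in X in _ -> X]eq_bigr do rewrite mulNr mulrC.
  by rewrite sumrN => /eqP; rewrite addrC addr_eq0 => /eqP.
(* The term s = n is compared through |c + nu| <= nu, the earlier ones through the nonnegativity of
   the weights [- rbin (- nu) _]. *)
rewrite uS Vdm mulr_sumr [leRHS]big_ord_recr/= [leRHS]addrC.
apply: le_trans (ler_normD _ _) _; apply: lerD.
  by rewrite subSnn rbin1 opprK normrM mulrCA ler_pM// IH.
apply: le_trans (ler_norm_sum _ _ _) _; apply: ler_sum => s _.
have sn : (s < n)%N by [].
rewrite normrM mulrCA ger0_norm ?oppr_ge0 ?subSn ?rbinN_le0 1?ltnW//.
rewrite ler_wpM2l ?oppr_ge0 ?rbinN_le0// IH//.
by rewrite (leq_trans _ nm)// ltnW.
Qed.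

Lemma rbin_cvg0 (R : realType) (x : R) :
  0 <= x -> x < 1 -> rbin x n @[n --> \oo] --> 0.
Proof.
move=> x0 x1.
(* Each factor is 1 - (1 - x) / (i + 1), to which 1 + y <= exp y applies. *)
have le_exp n : rbin x n <= expR (- ((1 - x) * series harmonic n)).
  rewrite /series/= mulr_sumr -sumrN expR_sum /rbin big_mkord.
  apply: ler_prod => i _; rewrite divr_ge0 ?addr_ge0//=.
  apply: le_trans (expR_ge1Dx _).
  have i1 : i.+1%:R != 0 :> R by rewrite pnatr_eq0.
  rewrite le_eqVlt; apply/orP; left; apply/eqP.
  by rewrite -natr1 in i1 *; field.
have H : series (@harmonic R) n @[n --> \oo] --> +oo.
  apply: nondecreasing_dvgn_lt; last exact: dvg_harmonic.
  apply/nondecreasing_seqP => n.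
  by rewrite /series/= big_nat_recr//= lerDl.
have small : expR (- ((1 - x) * series harmonic n)) @[n --> \oo] --> (0 : R).
  have x1' : 0 < 1 - x by rewrite subr_gt0.
  apply: (cvg_comp _ (fun y : R => expR (- ((1 - x) * y))) H).
  exact: (cvg_comp _ (fun y : R => expR (- y)) (gt0_cvgMry x1' cvg_id)
    (@cvgr_expR R)).
apply: (squeeze_cvgr _ (cvg_cst 0) small).
by near=> n; rewrite rbin_ge0//= le_exp.
Unshelve. all: by end_near. Qed.

(** * Euler's integral and its functional equation *)

(* Exponent x rather than x - 1: Gamma x is the integral of gamma_kernel (x - 1). *)
Definition gamma_kernel (R : realType) (x s : R) : R := s `^ x * expR (- s).

Lemma gamma_kernel_ge0 (R : realType) (x s : R) : 0 <= gamma_kernel x s.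
Proof. by rewrite mulr_ge0 ?powR_ge0 ?expR_ge0. Qed.

Lemma measurable_gamma_kernel (R : realType) (x : R) (D : set R) :
  measurable_fun D (fun s => (gamma_kernel x s)%:E).
Proof.
apply: measurable_funTS; apply/measurable_EFinP; apply: measurable_funM.
  exact: measurable_powR.
apply: measurableT_comp; first exact: measurable_expR.
exact: oppr_measurable.
Qed.

(** The antiderivative of [expR (- s)] is [- expR (- s)]. Keeping away from 0 makes the power of [s]
    derivable on the whole segment for every real exponent. *)
Lemma gamma_kernel_by_parts (R : realType) (x a b : R) : 0 < a -> a < b ->
  (\int[lebesgue_measure]_(s in `[a, b]) (gamma_kernel x s)%:E =
   (gamma_kernel x a - gamma_kernel x b)%:E +
   x%:E * \int[lebesgue_measure]_(s in `[a, b]) (gamma_kernel (x - 1) s)%:E)%E.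
Proof.
move=> a0 ab.
have dp (y s : R) : 0 < s -> is_derive s 1 (@powR R ^~ y) (y * s `^ (y - 1)).
  exact: is_derive1_powR.
have de (s : R) : is_derive s 1 (fun s => - expR (- s)) (expR (- s)).
  by apply: is_derive_eq; rewrite mulrN1 opprK.
have pos (s : R) : s \in `[a, b]%R -> 0 < s.
  by rewrite in_itv/= => /andP[/(lt_le_trans a0)].
have posoo (s : R) : s \in `]a, b[%R -> 0 < s.
  by move=> /subset_itv_oo_cc /pos.
have cp (y : R) : {within `[a, b], continuous (@powR R ^~ y)}.
  apply: derivable_within_continuous => s /pos s0.
  by have [] := dp y s s0.
have cG : continuous (fun s : R => - expR (- s)).
  move=> s; apply: differentiable_continuous; apply/derivable1_diffP.
  by have [] := de s.
have cg : continuous (fun s : R => expR (- s)).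
  move=> s; apply: continuous_comp; first exact: opp_continuous.
  exact: continuous_expR.
have cpx (y s : R) : 0 < s -> {for s, continuous (@powR R ^~ y)}.
  move=> s0; apply: differentiable_continuous; apply/derivable1_diffP.
  by have [] := dp y s s0.
have := @integration_by_parts R (@powR R ^~ x) (fun s => - expR (- s))
  (fun s => x * s `^ (x - 1)) (fun s => expR (- s)) a b ab.
rewrite /gamma_kernel => -> //.
- have -> : (fun s : R => (x * s `^ (x - 1) * - expR (- s))%:E) =
      (fun s => (- x)%:E * (s `^ (x - 1) * expR (- s))%:E)%E.
    by apply/funext => s; rewrite -EFinM; congr EFin; ring.
  rewrite integralZl//.
    rewrite EFinN mulNe oppeK; congr (_%:E + _)%E; ring.
  apply: continuous_compact_integrable; first exact: segment_compact.
  move=> s; apply: cvgM; first exact: cp.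
  exact: (continuous_subspaceT cg).
- by move=> s; apply: cvgM; [exact: cvg_cst|exact: cp].
- split.
  + by move=> s /posoo s0; have [] := dp x s s0.
  + exact/cvg_at_right_filter/cpx.
  + exact/cvg_at_left_filter/cpx/(lt_trans a0 ab).
- by move=> s /posoo s0; rewrite derive1E; have [_ ->] := dp x s s0.
- exact: continuous_subspaceT.
- split.
  + by move=> s _; have [] := de s.
  + exact/cvg_at_right_filter/cG.
  + exact/cvg_at_left_filter/cG.
- by move=> s _; rewrite derive1E; have [_ ->] := de s.
Qed.

(** Monotone convergence along segments exhausting the half-line. The shift by 2 makes the endpoints
    strictly ordered already at n = 0. *)
Lemma gamma_kernel_cvg_integral (R : realType) (x : R) :
  (\int[lebesgue_measure]_(s in `[((n.+2%:R)^-1)%R, n.+2%:R%R]) (gamma_kernel x s)%:E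
     @[n --> \oo] -->
   \int[lebesgue_measure]_(s in `]0%R, +oo[) (gamma_kernel x s)%:E)%E.
Proof.
have -> : [set` `]0%R, +oo[] =
    \bigcup_n [set` `[(n.+2%:R : R)^-1, n.+2%:R]].
  apply/seteqP; split => [s|s [n _]] /=; rewrite !in_itv/=; last first.
    by rewrite andbT => /andP[+ _]; apply: lt_le_trans; rewrite invr_gt0.
  rewrite andbT => s0.
  (* The sum s + 1/s bounds both s and 1/s, so one index serves both endpoints. *)
  exists (Num.truncn (s + s^-1)) => //=; rewrite in_itv/=.
  have si : 0 < s^-1 by rewrite invr_gt0.
  have le1 : s + s^-1 <= (Num.truncn (s + s^-1)).+2%:R.
    by rewrite ltW// (lt_trans (truncnS_gt _))// ltr_nat.
  apply/andP; split; last by apply: le_trans le1; rewrite lerDl ltW.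
  rewrite -[leRHS]invrK lef_pV2 ?posrE ?invr_gt0//.
  by apply: le_trans le1; rewrite lerDr ltW.
apply: ge0_nondecreasing_set_cvg_integral.
- apply/nondecreasing_seqP => n; rewrite subsetEset.
  by apply: subset_itv; rewrite bnd_simp ?lef_pV2 ?posrE ?ltr0n// ler_nat.
- by move=> n; exact: measurable_itv.
- by move=> n; exact: measurable_gamma_kernel.
- by move=> n s _; rewrite lee_fin gamma_kernel_ge0.
Qed.

(** For an integer m > x and s >= 1, the bound s^(m+1) / (m+1)! <= exp s makes the kernel at most
    (m+1)! / s. *)
Lemma gamma_kernel_cvgy (R : realType) (x : R) :
  gamma_kernel x (n.+2%:R) @[n --> \oo] --> 0.
Proof.
set m := (Num.truncn x).+1.
have bound n : gamma_kernel x n.+2%:R <= (m.+1)`!%:R * harmonic n.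
  have s0 : 0 < n.+2%:R :> R by [].
  rewrite /gamma_kernel expRN ler_pdivrMr ?expR_gt0//.
  have sxm : n.+2%:R `^ x <= n.+2%:R ^+ m :> R.
    rewrite -powR_mulrn//; apply: ler_powR; first by rewrite ler1n.
    by rewrite ltW// truncnS_gt.
  apply: le_trans sxm _.
  apply: (@le_trans _ _ ((m.+1)`!%:R * n.+2%:R^-1 * expR n.+2%:R)); last first.
    rewrite ler_pM2r ?expR_gt0// ler_pM2l ?ltr0n ?fact_gt0//=.
    by rewrite lef_pV2 ?posrE// ler_nat.
  rewrite mulrAC ler_pdivlMr// -exprSr mulrC -ler_pdivrMr ?ltr0n ?fact_gt0//.
  by apply: le_trans (expR_ge1Dxn m (ltW s0)); rewrite lerDr.
apply: (squeeze_cvgr (f := fun=> 0) (h := fun n => (m.+1)`!%:R * harmonic n)).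
- by near=> n; rewrite gamma_kernel_ge0/= bound.
- exact: cvg_cst.
- rewrite -[X in _ --> X](mulr0 (m.+1)`!%:R).
  by apply: cvgM; [exact: cvg_cst|exact: cvg_harmonic].
Unshelve. all: by end_near. Qed.

Lemma cvg_invn2 (R : realType) : (n.+2%:R : R)^-1 @[n --> \oo] --> 0.
Proof. by have := @cvg_harmonic R; rewrite -cvg_shiftS. Qed.

Lemma cvg_expRN_invn2 (R : realType) :
  expR (- (n.+2%:R : R)^-1) @[n --> \oo] --> (1 : R).
Proof.
rewrite -[X in _ --> X]expR0 -[X in _ --> expR X]oppr0.
apply: continuous_cvg; first exact: continuous_expR.
by apply: cvgN; exact: cvg_invn2.
Qed.

Lemma gamma_kernel_cvg0 (R : realType) (x : R) : 0 < x ->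
  gamma_kernel x (n.+2%:R)^-1 @[n --> \oo] --> 0.
Proof.
move=> x0; rewrite -[X in _ --> X](mul0r 1); apply: cvgM; last exact: cvg_expRN_invn2.
have /cvg_at_rightP := powR_cvg0 x0; apply; split; last exact: cvg_invn2.
by move=> n; rewrite invr_gt0.
Qed.

Lemma invn2_lt (R : realType) n :
  (0 < (n.+2%:R : R)^-1) * ((n.+2%:R : R)^-1 < n.+2%:R).
Proof.
by split; [rewrite invr_gt0|rewrite (@lt_trans _ _ 1) ?invf_lt1 ?ltr1n].
Qed.

(** Limit of the integration by parts, whose boundary terms vanish at both ends. The identity lives
    in the extended reals, so finiteness is not presupposed. *)
Lemma gamma_integralS (R : realType) (x : R) : 0 < x ->
  (\int[lebesgue_measure]_(s in `]0%R, +oo[) (gamma_kernel x s)%:E =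
   x%:E * \int[lebesgue_measure]_(s in `]0%R, +oo[) (gamma_kernel (x - 1) s)%:E)%E.
Proof.
move=> x0; rewrite -[RHS]add0e.
apply: cvg_unique (@gamma_kernel_cvg_integral R x) _ => //.
suff: ((gamma_kernel x (n.+2%:R)^-1 - gamma_kernel x n.+2%:R)%:E + x%:E *
      (\int[lebesgue_measure]_(s in `[((n.+2%:R)^-1)%R, n.+2%:R%R])
        (gamma_kernel (x - 1) s)%:E) @[n --> \oo] -->
    0 + x%:E * \int[lebesgue_measure]_(s in `]0%R, +oo[)
        (gamma_kernel (x - 1) s)%:E)%E.
  move=> H; apply: (cvg_trans _ H); apply: near_eq_cvg; apply: nearW => n.
  by rewrite [RHS]gamma_kernel_by_parts ?invn2_lt.
apply: cvgeD; [by []| |by apply: cvgeZl => //; exact: gamma_kernel_cvg_integral].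
apply: cvg_EFin; first exact: nearW.
rewrite /= -[X in _ --> X]subr0; apply: cvgB; first exact: gamma_kernel_cvg0.
exact: gamma_kernel_cvgy.
Qed.

(** At exponent 0 only the boundary terms of the integration by parts remain; they tend to 1 at the
    left end and to 0 at the right end. *)
Lemma gamma_integral1 (R : realType) :
  (\int[lebesgue_measure]_(s in `]0%R, +oo[) (gamma_kernel (0 : R) s)%:E = 1)%E.
Proof.
apply: cvg_unique (@gamma_kernel_cvg_integral R 0) _ => //.
suff: ((gamma_kernel 0 (n.+2%:R : R)^-1 - gamma_kernel 0 n.+2%:R)%:E
    @[n --> \oo] --> 1)%E.
  move=> H; apply: (cvg_trans _ H); apply: near_eq_cvg; apply: nearW => n.
  by rewrite gamma_kernel_by_parts ?invn2_lt// mul0e adde0.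
apply: cvg_EFin; first exact: nearW.
rewrite /= -[X in _ --> X]subr0; apply: cvgB; last exact: gamma_kernel_cvgy.
rewrite /gamma_kernel; under eq_fun do rewrite powRr0 mul1r.
exact: cvg_expRN_invn2.
Qed.

(* Finite by s^(x+1) <= 1 + s and positive by 1 <= s^x + s^(x+1), both through the
   functional equation I (x + 1) = (x + 1) I x. *)
Lemma gamma_integral_fin_gt0 (R : realType) (x : R) : -1 < x -> x <= 0 ->
  (\int[lebesgue_measure]_(s in `]0%R, +oo[) (gamma_kernel x s)%:E \is a fin_num)%E /\
  (0 < \int[lebesgue_measure]_(s in `]0%R, +oo[) (gamma_kernel x s)%:E)%E.
Proof.
pose I (y : R) := (\int[lebesgue_measure]_(s in `]0%R, +oo[) (gamma_kernel y s)%:E)%E.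
rewrite -/(I x) => xN1 x0.
have x1 : 0 < x + 1 by lra.
have IS : I (x + 1) = ((x + 1)%:E * I x)%E.
  by rewrite [LHS]gamma_integralS// addrK.
have I1 : I 1 = 1%E.
  by rewrite [LHS]gamma_integralS// subrr gamma_integral1 mule1.
have I_ge0 y : (0 <= I y)%E.
  by apply: integral_ge0 => s _; rewrite lee_fin gamma_kernel_ge0.
have le2 : (I (x + 1)%R <= I 0%R + I 1%R)%E.
  rewrite -ge0_integralD//; try exact: measurable_gamma_kernel.
  - apply: ge0_le_integral => //; try exact: measurable_gamma_kernel.
    + by move=> s _; rewrite lee_fin gamma_kernel_ge0.
    + by apply: emeasurable_funD; exact: measurable_gamma_kernel.
    move=> s /=; rewrite in_itv/= andbT => s0; rewrite -EFinD lee_fin -mulrDl.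
    rewrite ler_wpM2r ?expR_ge0// powRr0 powRr1 ?(ltW s0)//.
    have [s1|s1] := leP s 1.
      by rewrite ler_wpDr ?(ltW s0)// -[leRHS](powRr0 s) ger_powR ?s0// ltW.
    by rewrite ler_wpDl// -[leRHS]powRr1 ?(ltW s0)// ler_powR ?(ltW s1)//; lra.
  - by move=> s _; rewrite lee_fin gamma_kernel_ge0.
  - by move=> s _; rewrite lee_fin gamma_kernel_ge0.
have le1 : (I 0%R <= I x + I (x + 1)%R)%E.
  rewrite -ge0_integralD//; try exact: measurable_gamma_kernel.
  - apply: ge0_le_integral => //; try exact: measurable_gamma_kernel.
    + by move=> s _; rewrite lee_fin gamma_kernel_ge0.
    + by apply: emeasurable_funD; exact: measurable_gamma_kernel.
    move=> s /=; rewrite in_itv/= andbT => s0; rewrite -EFinD lee_fin -mulrDl.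
    rewrite ler_wpM2r ?expR_ge0//.
    have [s1|s1] := leP s 1.
      by rewrite ler_wpDr ?powR_ge0// ger_powR ?s0.
    by rewrite ler_wpDl ?powR_ge0// ler_powR// ?(ltW s1)//; lra.
  - by move=> s _; rewrite lee_fin gamma_kernel_ge0.
  - by move=> s _; rewrite lee_fin gamma_kernel_ge0.
have I0 : I 0 = 1%E by exact: gamma_integral1.
move: le2 le1; rewrite I0 I1 IS; move: (I_ge0 x).
(* The value +oo would make (x + 1) I x infinite, against the bound 2. For a finite r >= 0, the
   inequality 1 <= r + (x + 1) r forces r > 0. *)
case: (I x) => [r| |]//=; last by rewrite gt0_muley ?lte_fin.
move=> _ _; rewrite -EFinM -EFinD lee_fin => h; split=> //.
rewrite lte_fin; nra.
Qed.

(** * The Gamma function at positive arguments *)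

Lemma GammaE (R : realType) (x : R) : 0 < x ->
  Gamma x = fine (\int[lebesgue_measure]_(s in `]0%R, +oo[) (gamma_kernel (x - 1) s)%:E)%E.
Proof. by move=> x0; rewrite /Gamma x0 big_ord0 divr1 addr0. Qed.

Lemma GammaS (R : realType) (x : R) : 0 < x -> Gamma (x + 1) = x * Gamma x.
Proof.
move=> x0; rewrite !GammaE ?addr_gt0// addrK gamma_integralS//.
(* Infinite values are preserved by the factor x > 0 and sent to 0 by [fine], so the identity holds
   in these cases too. *)
case: (\int[_]_(_ in _) _)%E => [r| |] //=; rewrite mulr0.
  by rewrite gt0_muley ?lte_fin.
by rewrite gt0_muleNy ?lte_fin.
Qed.

Lemma Gamma_neq0 (R : realType) (x : R) : 0 < x -> x <= 1 -> Gamma x != 0.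
Proof.
move=> x0 x1; rewrite GammaE//.
have [|| fin pos] := @gamma_integral_fin_gt0 R (x - 1); [lra|lra|].
by rewrite gt_eqF// fine_gt0// pos ltey_eq fin.
Qed.

(** Each step in [k] applies the functional equation once above and once below the fraction bar;
    this turns the Taylor monomials into finite products. *)
Lemma Gamma_rbin (R : realType) (x : R) k : 0 < x -> x <= 1 ->
  Gamma (x + k%:R) / (Gamma (k%:R + 1) * Gamma x) = rbin x k.
Proof.
move=> x0 x1; have Gx := Gamma_neq0 x0 x1.
have G1 : Gamma (1 : R) = 1.
  by rewrite GammaE// subrr gamma_integral1.
elim: k => [|k IH].
  by rewrite addr0 add0r rbin0 G1 mul1r divff.
rewrite rbinS -IH -natr1 addrA.
rewrite (GammaS (x := x + k%:R)) ?ltr_wpDr// (GammaS (x := k%:R + 1)) ?ltr_wpDl//.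
by rewrite !invfM; ring.
Qed.

(** * From the fractional difference equation to sequences *)

Lemma RL_nabla_sumE (R : realType) (nu a : R) (u : R -> R) n :
  0 <= nu -> nu < 1 ->
  RL_nabla_sum nu a u (a + n%:R) =
  \sum_(s < n.+1) rbin (1 - nu) (n - s) * u (a + s%:R).
Proof.
move=> nu0 nu1; rewrite /RL_nabla_sum.
(* The sum over a finite set of reals is reindexed along the injection k -> a + k. *)
have -> : [set s | Nfrom a s /\ s <= a + n%:R] =
    (fun k : nat => a + k%:R) @` `I_n.+1.
  apply/seteqP; split => [s [[k _ <-]]|s [k /= kn <-]].
    by rewrite lerD2l ler_nat => kn; exists k.
  by split; [exists k|rewrite lerD2l ler_nat].
rewrite fsbig_image; last by move=> i j _ _ /addrI /eqP; rewrite eqr_nat => /eqP.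
rewrite -(fsbig_ord _ _ (fun s =>
  nabla_taylor (- nu) (a + n%:R) (rho (a + s%:R)) * u (a + s%:R))).
apply: eq_bigr => s _; congr (_ * _).
have sn : (s <= n)%N by rewrite -ltnS.
(* The shift in [rho] supplies the + 1 of Gamma (k + 1) = k! with k = n - s; the numerator then has
   argument (1 - nu) + k. *)
have tb : a + n%:R - rho (a + s%:R) = (n - s)%:R + 1.
  by rewrite natrB// /rho; ring.
rewrite -Gamma_rbin ?subr_gt0 ?gerBl// /nabla_taylor tb.
by congr (Gamma _ / (_ * Gamma _)); ring.
Qed.

Theorem theorem3p2 (R : realType) (a nu : R) (c : R -> R) :
  0 < nu -> nu < 1 ->
  (forall t : R, Nfrom (a + 1) t -> `|c t + nu| <= nu) ->
  forall u : R -> R,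
    (forall t : R, Nfrom (a + 1) t -> RL_nabla nu a u t = c t * u (t - 1)) ->
    u t @[t --> within (Nfrom a) (pinfty_nbhs R)] --> (0 : R).
Proof.
move=> nu0 nu1 cnu u equ.
have inN n : Nfrom (a + 1) (a + n.+1%:R).
  by exists n => //; rewrite -natr1; ring.
have rhoS n : a + n.+1%:R - 1 = a + n%:R by rewrite -natr1; ring.
have bound n : `|u (a + n%:R)| <= `|u (a + 0%:R)| * rbin nu n.
  apply: (rbin_comparison (c := fun n => c (a + n.+1%:R))
    (u := fun n => u (a + n%:R))); try exact: ltW; first by move=> m; exact: cnu.
  move=> m; have := equ _ (inN m).
  by rewrite /RL_nabla /nabla /rho rhoS !RL_nabla_sumE ?ltW.
have small : `|u (a + 0%:R)| * rbin nu n @[n --> \oo] --> 0.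
  rewrite -[X in _ --> X](mulr0 `|u (a + 0%:R)|).
  by apply: cvgM; [exact: cvg_cst|apply: rbin_cvg0; rewrite ?ltW].
apply/cvgrPdist_lt => e e0.
have [N _ HN] := cvgr0_norm_lt _ small _ e0.
(* A point t = a + n of the domain has n >= N as soon as t >= a + N, which carries the limit of the
   sequence over to the filter on the reals. *)
suff H : \forall t \near +oo, Nfrom a t -> `|0 - u t| < e by exact: H.
near=> t => -[n _ tn].
rewrite sub0r normrN -tn; apply: le_lt_trans (bound n)
  (le_lt_trans (ler_norm _) (HN n _)) => /=.
rewrite -(ler_nat R) -(lerD2l a) tn.
by near: t; apply: nbhs_pinfty_ge; exact: num_real.
Unshelve. all: by end_near. Qed.
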